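(* Let $F^N$ be a Finsler space with metric function $K(x,y)$ and metric tensor $g_{mn}(x,y)$, and let $R^N=\{M,a_{mn}(x)\}$ be a Riemannian space on the same manifold $M$. Consider the following conditions. (i) $F^N$ is conformally isomorphic to $R^N$: there is a transformation $\mathcal T$ of tangent vectors, not affecting the points $x\in M$, such that $\{g_{mn}(x,y)\}=\mathcal T\cdot\{t_{mn}(x,y)\}$ with $t_{mn}(x,y)=k^2(x,y)\,a_{mn}(x)$, where $k$ is the conformal multiplier. That is, writing $\mathcal T$ as $y^i=y^i(x,\zeta)$ with inverse $\zeta^i=\zeta^i(x,y)$, $$g_{mn}(x,y)=k^2(x,y)\,\frac{\partial\zeta^i}{\partial y^m}(x,y)\,\frac{\partial\zeta^j}{\partial y^n}(x,y)\,a_{ij}(x).$$ (ii) $\mathcal T$ sends unit vectors to unit vectors: for each $x\in M$, the indicatrix $\{y\in T_xM: K(x,y)=1\}$ is the image under $\mathcal T$ of the sphere $\{\zeta\in T_xM: a_{mn}(x)\zeta^m\zeta^n=1\}$. (iii) The conformal multiplier is a function of the Finsler metric function: $k=\varkappa(x,K)$ with $K=K(x,y)$. Conditions (i)-(iii) are realized if and only if the function $\varkappa$ is taken to be $$\varkappa=\frac1h\,K^{1-h}\quad\text{with}\quad h=h(x),$$ where $h$ is a positive scalar.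
   Context: $M$ is an $N$-dimensional differentiable manifold with local coordinates $x^i$, and $y^i$ are the components of tangent vectors $y\in T_xM$. The Finsler metric function $K(x,y)$ is positively homogeneous of degree 1 in $y$ and strongly convex, and its metric tensor is $g_{mn}=\frac12\,\partial^2K^2/\partial y^m\partial y^n$. $a_{mn}(x)$ is a Riemannian metric tensor on $M$. The transformation $\mathcal T$ acts in each tangent space: both $y$ and $\zeta$ belong to $T_xM$ with the same $x$, and $y=\mathcal T\cdot\zeta$ is a diffeomorphic transformation, of class $C^5$ with respect to the $y$-dependence and of class $C^4$ with respect to the $x$-dependence. Considerations are of a local nature.
   Formalization: The dimension N is taken at least 2 (the claim fails for N = 1), k is positive, and T is, in each tangent space, a homeomorphism fixing the zero vector and smooth away from it, which excludes translations and inversions, for which the claim fails. *)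

(* Defs.v *)
From mathcomp Require Import all_boot all_order all_algebra.
From mathcomp Require Import all_classical all_reals all_analysis.
Import numFieldNormedType.Exports.

Set Implicit Arguments.
Unset Strict Implicit.
Unset Printing Implicit Defensive.

Local Open Scope classical_set_scope.
Local Open Scope ring_scope.

(* The considerations being local, the manifold is (the image of) a coordinate
   chart: an open set M of R^N.  Points x and tangent vectors y, zeta are the
   row vectors of their coordinates.  Fields on M are total functions of x
   whose values matter only at points of M. *)

Section LocalCoordinates.
Context {R : realType} {N : nat}.
Implicit Types (M A : set 'rV[R]_N) (K : 'rV[R]_N -> 'rV[R]_N -> R)
  (a : 'rV[R]_N -> 'M[R]_N) (T Z : 'rV[R]_N -> 'rV[R]_N -> 'rV[R]_N)
  (k : 'rV[R]_N -> 'rV[R]_N -> R) (vk : 'rV[R]_N -> R -> R).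

Definition basis_vec (i : 'I_N) : 'rV[R]_N := delta_mx 0 i.

Definition nonzero : set 'rV[R]_N := [set y | y != 0].

(* Meaningful for open A: all partial derivatives of order at most n exist and
   are continuous on A. *)
Fixpoint class_C {W : normedModType R} (n : nat) (A : set 'rV[R]_N)
    (f : 'rV[R]_N -> W) {struct n} : Prop :=
  (forall x, A x -> {for x, continuous f}) /\
  if n is n'.+1 then
    forall i : 'I_N, (forall x, A x -> derivable f x (basis_vec i)) /\
                     class_C n' A (fun x => 'D_(basis_vec i) f x)
  else True.

Definition metric_tensor K (x y : 'rV[R]_N) (m n : 'I_N) : R :=
  2^-1 * 'D_(basis_vec m)
           (fun v => 'D_(basis_vec n) (fun u => K x u ^+ 2) v) y.

(* Regularity is the least one under which the metric tensors make sense
   and are continuous in the fibres; smoother metrics are included. *)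
Record Finsler_metric_function M K : Prop := {
  Finsler_continuous : forall x y : 'rV[R]_N, M x ->
    {for (x, y), continuous (fun p : 'rV[R]_N * 'rV[R]_N => K p.1 p.2)};
  Finsler_C2 : forall x, M x -> class_C 2 nonzero (K x);
  Finsler_pos : forall x y : 'rV[R]_N, M x -> y != 0 -> 0 < K x y;
  Finsler_homogeneous : forall (x y : 'rV[R]_N) (c : R), M x -> 0 < c ->
    K x (c *: y) = c * K x y;
  Finsler_strongly_convex : forall x y v : 'rV[R]_N,
    M x -> y != 0 -> v != 0 ->
    0 < \sum_(m < N) \sum_(n < N) metric_tensor K x y m n * v 0 m * v 0 n }.

Definition Riemannian_square a (x v : 'rV[R]_N) : R :=
  \sum_(m < N) \sum_(n < N) a x m n * v 0 m * v 0 n.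

Record Riemannian_metric M a : Prop := {
  Riemannian_continuous : forall x, M x -> {for x, continuous a};
  Riemannian_symmetric : forall x m n, M x -> a x m n = a x n m;
  Riemannian_posdef : forall x v : 'rV[R]_N, M x -> v != 0 ->
    0 < Riemannian_square a x v }.

(* [T x] is y = y(x, zeta) and [Z x] its inverse zeta = zeta(x, y), both from
   T_xM to itself.  As for every object of Finsler geometry, differentiability
   is required away from the zero vector only: a map which is homogeneous of a
   degree h <> 1 is never a diffeomorphism at 0.  At 0 the transformation is
   a homeomorphism fixing the zero vector; this rules out inversions such as
   zeta = y / |y|^2. *)
Record tangent_transformation M T Z : Prop := {
  transf_K : forall x, M x -> cancel (T x) (Z x);
  transf_inv_K : forall x, M x -> cancel (Z x) (T x);
  transf_0 : forall x, M x -> T x 0 = 0;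
  transf_continuous : forall x, M x -> continuous (T x);
  transf_inv_continuous : forall x, M x -> continuous (Z x);
  transf_C5 : forall x, M x -> class_C 5 nonzero (T x);
  transf_inv_C5 : forall x, M x -> class_C 5 nonzero (Z x);
  transf_C4 : forall v : 'rV[R]_N, v != 0 -> class_C 4 M (fun x => T x v);
  transf_inv_C4 : forall v : 'rV[R]_N, v != 0 -> class_C 4 M (fun x => Z x v) }.

Definition conformally_isomorphic M K a T Z k : Prop :=
  tangent_transformation M T Z /\
  (forall x y : 'rV[R]_N, M x -> y != 0 -> 0 < k x y) /\
  (forall (x y : 'rV[R]_N) (m n : 'I_N), M x -> y != 0 ->
     metric_tensor K x y m n =
     k x y ^+ 2 *
       \sum_(i < N) \sum_(j < N)
         'D_(basis_vec m) (fun u => Z x u 0 i) y *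
         'D_(basis_vec n) (fun u => Z x u 0 j) y * a x i j).

Definition unit_vectors_to_unit_vectors M K a T : Prop :=
  forall x, M x ->
    [set y | K x y = 1] = T x @` [set v | Riemannian_square a x v = 1].

Definition multiplier_function_of_metric M K k vk : Prop :=
  forall x y : 'rV[R]_N, M x -> y != 0 -> k x y = vk x (K x y).

End LocalCoordinates.

(* Main.v *)
Require Import Defs.
From HB Require Import structures.
From mathcomp Require Import all_boot all_order all_algebra.
From mathcomp Require Import all_classical all_reals all_analysis.
From mathcomp Require Import ring lra.
Import Order.TTheory GRing.Theory Num.Theory.
Import numFieldNormedType.Exports.

(** Everything happens in one tangent space; |.| is the norm of a(x) and k is
    a function vk(K) of K.

    Homogeneity of K^2 (Euler) gives g_y(y, v) = K(y) dK_y(v) and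
    g_(sy) = g_y.  Read through g = vk(K)^2 Z^* a, the first identity says two
    things ([ray_speed], [dK_bound]): along a ray s u with K(u) = 1 the curve
    Z(s u) has speed 1 / vk(s), and |dK(v)| <= vk(K) |DZ v|.  Write
    P_u(s) = |Z(s u)| for the profile of that ray, so that |P_u'| <= 1 / vk.

    The profile does not depend on the ray.  Follow the curve T(s zeta) from 0
    and let c(s) be its value of K: then |c'| <= vk(c) |zeta|, hence
    (P_u o c)' <= |zeta|, and P_u(K(y)) <= |Z y| for every y and every unit u
    ([profile_height_le]).  Applied to vectors on two rays, this inequality
    gives |Z y| = P_u(K(y)) ([nrm_Z_profile]): the norm of Z y is a function of
    K(y) alone.  Consequently P_u(c(s)) = s |zeta|, whose derivative forces
    |P_u'| = 1 / vk; since P_u is then injective, vanishes at 0 and is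
    nonnegative, P_u' = 1 / vk ([is_derive_profile_vk]).

    If vk(s) = s^(1-h) / h then P_u' = h s^(h-1), so |Z y| = K(y)^h, and K = 1
    exactly where |Z| = 1 ([profile_of_multiplier]).

    Conversely, the speed of Z(s u) equals the derivative of its norm, so by
    the equality case of Cauchy-Schwarz Z maps rays to rays
    ([Z_homothety]).  Differentiating P_u(K(y)) Z(s y) = P_u(s K(y)) Z(y) in a
    nonzero direction v with dK(v) = 0, which exists because N > 1, and
    comparing norms by means of g_(sy) = g_y, gives
    s P_u(1) vk(1) = P_u(s) vk(s) ([profile_vk_linear]).  If unit vectors go to
    unit vectors then P_u(1) = 1, and with h = 1 / vk(1) the equation
    P_u' = 1 / vk = h P_u / s yields P_u(s) = s^h and vk(s) = s^(1-h) / h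
    ([multiplier_of_unit]). *)

Set Implicit Arguments.
Unset Strict Implicit.
Unset Printing Implicit Defensive.

Local Open Scope classical_set_scope.
Local Open Scope ring_scope.

(** * Continuous partial derivatives and differentiability *)

Section PartialDerivatives.
Context {R : realType}.

Lemma mean_value_bound (f df : R -> R) (e t : R) :
  (forall s, `|s| <= `|t| -> is_derive s (1 : R) f (df s)) ->
  (forall s, `|s| <= `|t| -> `|df s| <= e) -> `|f t - f 0| <= e * `|t|.
Proof.
move=> fd fe.
have W a b : a <= b -> (forall s, s \in `[a, b]%R -> `|s| <= `|t|) ->
    `|f b - f a| <= e * (b - a).
  move=> ab abt.
  have [||z /abt zt ->] := @MVT_segment R f df a b ab.
  - by move=> z zab; apply/fd/abt/subset_itv_oo_cc.
  - apply: derivable_within_continuous => z /abt zt.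
    by have [] := fd _ zt.
  - by rewrite normrM (@ger0_norm _ (b - a)) ?subr_ge0// ler_wpM2r ?subr_ge0 ?fe.
have [t0|t0] := leP 0 t.
- have := W _ _ t0; rewrite subr0 (ger0_norm t0); apply => s.
  by rewrite in_itv/= => /andP[s0 st]; rewrite ger0_norm.
- rewrite distrC; have := W _ _ (ltW t0); rewrite sub0r (ltr0_norm t0); apply => s.
  by rewrite in_itv/= => /andP[s0 st]; rewrite ler0_norm ?lerN2.
Qed.

Lemma ler_coord_norm {N} (v : 'rV[R]_N) i : `|v 0 i| <= `|v|.
Proof.
rewrite [leRHS]/Num.Def.normr/= mx_normrE.
exact: (le_bigmax _ (fun ij : 'I_1 * 'I_N => `|v ij.1 ij.2|) (0, i)).
Qed.

Lemma norm_le_coord {N} (v w : 'rV[R]_N) :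
  (forall i, `|v 0 i| <= `|w 0 i|) -> `|v| <= `|w|.
Proof.
move=> vw; rewrite [leLHS]/Num.Def.normr/= mx_normrE.
rewrite bigmax_le ?normr_ge0// => -[i j] _ /=; rewrite ord1.
exact: le_trans (vw _) (ler_coord_norm _ _).
Qed.

Definition truncate {N} (k : nat) (v : 'rV[R]_N) : 'rV[R]_N :=
  \row_j (if (j < k)%N then v 0 j else 0).

Lemma truncateS {N} (v : 'rV[R]_N) (k : 'I_N) :
  truncate k.+1 v = truncate k v + v 0 k *: basis_vec k.
Proof.
apply/rowP => j; rewrite !mxE eqxx/= ltnS leq_eqVlt (eq_sym _ k) -val_eqE/=.
rewrite eq_sym; case: ltngtP => jk /=; rewrite ?mulr0 ?mulr1 ?addr0 ?add0r//.
by congr (v _ _); apply: val_inj.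
Qed.

Lemma row_sum_basis {N} (v : 'rV[R]_N) : v = \sum_i v 0 i *: basis_vec i.
Proof. exact: row_sum_delta. Qed.

Lemma is_derive_line {N} (f : 'rV[R]_N -> R) (y v : 'rV[R]_N) (t : R) :
  derivable f (y + t *: v) v ->
  is_derive t (1 : R) (fun s : R => f (y + s *: v)) ('D_v f (y + t *: v)).
Proof.
move=> df; suff E : (fun h : R => h^-1 *:
      (((fun s : R => f (y + s *: v)) \o shift t) (h *: 1) - f (y + t *: v)))
    = (fun h : R => h^-1 *:
      ((f \o shift (y + t *: v)) (h *: v) - f (y + t *: v))).
  by split; [rewrite /derivable E|rewrite /derive E].
apply/funext => h /=; congr (_ *: (f _ - _)).
by rewrite [h%:A]mulr1 scalerDl addrCA.
Qed.

(** The increment from x to x + h is split along the coordinate axes.  Each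
    partial increment is compared with h_i D_i f(x) by the mean value theorem;
    the intermediate points stay within |h| of x because the norm is the
    maximum norm. *)
Lemma continuous_partials_differentiable {N} (A : set 'rV[R]_N)
    (f : 'rV[R]_N -> R) x : open A -> A x ->
  (forall i z, A z -> derivable f z (basis_vec i)) ->
  (forall i : 'I_N, {for x, continuous (fun z => 'D_(basis_vec i) f z)}) ->
  differentiable f x.
Proof.
move=> oA Ax df cdf.
pose l (h : 'rV[R]_N) : R := \sum_i h 0 i * 'D_(basis_vec i) f x.
have l_lin : linear l.
  move=> a u v; rewrite /l scaler_sumr -big_split/=; apply: eq_bigr => i _.
  by rewrite !mxE mulrDl -mulrA.
pose lM := GRing.isLinear.Build _ _ _ _ _ l_lin.
pose L : {linear 'rV[R]_N -> R} := HB.pack l lM.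
have cL : continuous L.
  move=> y; rewrite /L/= /l.
  apply: (@cvg_big _ _ _ _ _ _ _ _ _ _ _ (nbhs_filter y)) => [|i _].
    exact: add_continuous.
  by apply: cvgMr_tmp; exact: (@coord_continuous _ _ _ 0 i y).
have dL (e : R) : 0 < e ->
    \forall h \near nbhs (0 : 'rV[R]_N), `|f (h + x) - (f x + l h)| <= e * `|h|.
  move=> e_gt0.
  have e'0 : 0 < e / N.+1%:R by rewrite divr_gt0.
  have : \forall y \near x, A y /\ forall i : 'I_N,
      `|'D_(basis_vec i) f x - 'D_(basis_vec i) f y| < e / N.+1%:R.
    apply: filterI; first exact: (open_nbhs_nbhs (conj oA Ax)).
    suff : forall i : 'I_N, \forall y \near x,
        `|'D_(basis_vec i) f x - 'D_(basis_vec i) f y| < e / N.+1%:R.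
      have FF : Filter (nbhs x) by exact: nbhs_filter.
      by move=> /(filter_forall FF).
    move=> i.
    by move/cvgrPdist_lt: (cdf i); apply.
  move=> /nbhs_ballP[d /= d0 dP].
  apply/nbhs_ballP; exists d => //= h; rewrite -ball_normE/= sub0r normrN => hd.
  have near_x v : `|v| <= `|h| -> A (x + v) /\ forall i : 'I_N,
      `|'D_(basis_vec i) f x - 'D_(basis_vec i) f (x + v)| < e / N.+1%:R.
    move=> vh; apply: dP; rewrite -ball_normE/= opprD addNKr normrN.
    exact: le_lt_trans hd.
  have -> : f (h + x) - (f x + l h) = \sum_(i < N)
      (f (x + truncate i.+1 h) - f (x + truncate i h)
       - h 0 i * 'D_(basis_vec i) f x).
    rewrite sumrB -/(l h) opprD addrA; congr (_ - _).
    rewrite -(big_mkord xpredT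
      (fun i => f (x + truncate i.+1 h) - f (x + truncate i h))).
    rewrite telescope_sumr//.
    have -> : truncate 0 h = 0 by apply/rowP => j; rewrite !mxE.
    have -> : truncate N h = h by apply/rowP => j; rewrite !mxE ltn_ord.
    by rewrite addr0 [h + x]addrC.
  apply: le_trans (ler_norm_sum _ _ _) _.
  apply: (@le_trans _ _ (\sum_(i < N) e / N.+1%:R * `|h|)).
    apply: ler_sum => i _.
    pose g t :=
      f (x + truncate i h + t *: basis_vec i) - t * 'D_(basis_vec i) f x.
    have tr t : `|t| <= `|h 0 i| -> `|truncate i h + t *: basis_vec i| <= `|h|.
      move=> th; apply: norm_le_coord => j; rewrite !mxE eqxx/=.
      have [->|ji] := eqVneq j i; first by rewrite ltnn mulr1 add0r.
      by rewrite mulr0 addr0; case: ifP; rewrite ?normr0.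
    have -> : f (x + truncate i.+1 h) - f (x + truncate i h)
        - h 0 i * 'D_(basis_vec i) f x = g (h 0 i) - g 0.
      by rewrite /g truncateS addrA scale0r addr0; ring.
    apply: (@le_trans _ _ (e / N.+1%:R * `|h 0 i|)); last first.
      by apply: ler_wpM2l; [exact: ltW|exact: ler_coord_norm].
    apply: (@mean_value_bound g (fun t =>
      'D_(basis_vec i) f (x + truncate i h + t *: basis_vec i)
      - 'D_(basis_vec i) f x)) => t th.
      apply: is_deriveB.
        apply: is_derive_line.
        apply: df.
        by rewrite -addrA; have [] := near_x _ (tr _ th).
      by apply: is_derive_eq; rewrite scaler0 add0r; exact: mulr1.
    by rewrite -addrA distrC ltW//; have [_] := near_x _ (tr _ th).
  rewrite sumr_const card_ord -[leLHS]mulr_natl mulrA ler_wpM2r ?normr_ge0//.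
  by rewrite mulrCA ler_piMr ?(ltW e_gt0)// ler_pdivrMr// mul1r ler_nat.
have E : 'd f x = L :> ('rV[R]_N -> R).
  by apply: diff_unique cL _; apply/eqaddoP => e /dL.
by apply/diff_locallyP; rewrite E; split => //; apply/eqaddoP => e /dL.
Qed.

Lemma class_C1_differentiable {N n} (A : set 'rV[R]_N) (f : 'rV[R]_N -> R) x :
  open A -> class_C n.+1 A f -> A x -> differentiable f x.
Proof.
move=> oA [_ C1] Ax; apply: (continuous_partials_differentiable oA Ax) => [i|i].
  by have [] := C1 i.
by have [_] := C1 i; case: n {C1} => [|n] [+ _]; apply.
Qed.

Lemma differentiable_row {N} (V : normedModType R) (f : V -> 'rV[R]_N) x :
  (forall i, differentiable (fun y => f y 0 i) x) -> differentiable f x.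
Proof.
move=> df; have -> : f = \sum_i (fun y => f y 0 i *: basis_vec i).
  apply/funext => y; rewrite fct_sumE; exact: row_sum_basis.
by apply: differentiable_sum => i; exact: differentiableZl.
Qed.

Lemma derive_coord {N} (V : normedModType R) (f : V -> 'rV[R]_N) x v i :
  derivable f x v -> 'D_v (fun y => f y 0 i) x = 'D_v f x 0 i.
Proof. by move=> /derive_mx ->; rewrite mxE. Qed.

Lemma class_C1_differentiable_row {N p n} (A : set 'rV[R]_N)
    (f : 'rV[R]_N -> 'rV[R]_p) x :
  open A -> class_C n.+1 A f -> A x -> differentiable f x.
Proof.
move=> oA [_ C1] Ax; apply: differentiable_row => j.
have Cf i z : A z -> derivable f z (basis_vec i) by have [+ _] := C1 i; apply.
apply: (continuous_partials_differentiable oA Ax) => [i z Az|i].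
  exact: ((derivable_mxP f z _).1 (Cf i z Az) 0 j).
have cD : {for x, continuous ('D_(basis_vec i) f)}.
  by have [_] := C1 i; case: n {C1} => [|n] [+ _]; apply.
rewrite /prop_for /continuous_at derive_coord; last exact: Cf.
have E : \forall z \near x,
    'D_(basis_vec i) f z 0 j = 'D_(basis_vec i) (fun y => f y 0 j) z.
  apply: (@filterS _ (nbhs x) _ A); last exact: open_nbhs_nbhs.
  by move=> z Az /=; rewrite (derive_coord j (Cf i z Az)).
apply: (cvg_trans (near_eq_cvg E)).
exact: (continuous_comp cD (@coord_continuous _ _ _ 0 j _)).
Qed.

Lemma derive_sum_basis {N} (W : normedModType R) (f : 'rV[R]_N -> W) x v :
  differentiable f x -> 'D_v f x = \sum_i v 0 i *: 'D_(basis_vec i) f x.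
Proof.
move=> df; rewrite deriveE// {1}(row_sum_basis v) linear_sum.
by apply: eq_bigr => i _; rewrite linearZ deriveE.
Qed.

Lemma derive_comb {N} (W : normedModType R) (f : 'rV[R]_N -> W) x a v b w :
  differentiable f x ->
  'D_(a *: v + b *: w) f x = a *: 'D_v f x + b *: 'D_w f x.
Proof. by move=> df; rewrite !deriveE// linearD !linearZ. Qed.

Lemma is_derive_comp_curve {N} (W : normedModType R) (f : 'rV[R]_N -> W)
    (c : R -> 'rV[R]_N) (t : R) w :
  differentiable f (c t) -> is_derive t (1 : R) c w ->
  is_derive t (1 : R) (fun s => f (c s)) ('D_w f (c t)).
Proof.
move=> df [/derivable1_diffP dc <-].
have dfc : differentiable (f \o c) t by exact: differentiable_comp.
split; first exact/derivable1_diffP.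
by rewrite (deriveE _ dfc) diff_comp//= !deriveE.
Qed.

Lemma is_derive_coord {N} (c : R -> 'rV[R]_N) (t : R) w i :
  is_derive t (1 : R) c w -> is_derive t (1 : R) (fun s => c s 0 i) (w 0 i).
Proof.
move=> [dc <-]; rewrite -derive_coord//.
by apply/derivableP; exact: ((derivable_mxP _ _ _).1 dc).
Qed.

Lemma is_derive_ray {N} (v : 'rV[R]_N) (t : R) :
  is_derive t (1 : R) (fun s : R => s *: v) v.
Proof.
have dv : is_diff t ( *:%R ^~ v) ( *:%R ^~ v) by exact: is_diff_scalel.
split; first exact/derivable1_diffP.
by rewrite deriveE// diff_val scale1r.
Qed.

Lemma is_derive_affine {N} (y v : 'rV[R]_N) (t : R) :
  is_derive t (1 : R) (fun s : R => y + s *: v) v.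
Proof.
have dv := is_derive_ray v t.
rewrite -[X in is_derive _ _ _ X]add0r.
exact: is_deriveD.
Qed.

(** The relation f(c u) = d f(u), differentiated at u = y along v. *)
Lemma derive_scale {N} (W : normedModType R) (f : 'rV[R]_N -> W) (c d : R) y v :
  (forall u, f (c *: u) = d *: f u) -> differentiable f y ->
  differentiable f (c *: y) -> c *: 'D_v f (c *: y) = d *: 'D_v f y.
Proof.
move=> fc dfy dfcy.
have dl : is_derive (0 : R) (1 : R) (fun s : R => y + s *: v) v.
  exact: is_derive_affine.
have d1 : is_derive (0 : R) (1 : R) (fun s : R => c *: (y + s *: v)) (c *: v).
  exact: is_deriveZ.
have /= -> : c *: 'D_v f (c *: y) = 'D_(c *: v) f (c *: y).
  by rewrite !deriveE// linearZ.
have := @is_derive_comp_curve _ _ f _ _ _ _ d1.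
rewrite scale0r addr0 => /(_ dfcy) [_ <-].
have := @is_derive_comp_curve _ _ f _ _ _ _ dl.
rewrite scale0r addr0 => /(_ dfy) [dfl <-].
under [in LHS]eq_fun do rewrite fc.
exact: deriveZ.
Qed.

End PartialDerivatives.

Lemma derive0_pos_cst {R : realType} (f : R -> R) :
  (forall s : R, 0 < s -> is_derive s (1 : R) f 0) ->
  forall s t, 0 < s -> 0 < t -> f s = f t.
Proof.
move=> df s t; wlog st : s t / s <= t.
  move=> W s0 t0; have [st|/ltW ts] := leP s t; first exact: W.
  by symmetry; exact: W.
move=> s0 _; apply/esym/eqP; rewrite -subr_eq0.
have [||x _ ->] := @MVT_segment R f (cst 0) s t st; last by rewrite mul0r.
- by move=> x; rewrite in_itv/= => /andP[sx _]; apply: df; exact: lt_trans sx.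
- apply: derivable_within_continuous => x; rewrite in_itv/= => /andP[sx _].
  by have [] := df _ (lt_le_trans s0 sx).
Qed.

(** Euler's identity in degree one: s |-> f(y + s y) is affine near 0. *)
Lemma Euler_homogeneous {R : realType} {N} (f : 'rV[R]_N -> R) y :
  (forall c, 0 < c -> f (c *: y) = c * f y) -> differentiable f y ->
  'D_y f y = f y.
Proof.
move=> fh df.
have dl : is_derive (0 : R) (1 : R) (fun s : R => y + s *: y) y.
  exact: is_derive_affine.
have := @is_derive_comp_curve _ _ _ f _ _ _ _ dl.
rewrite scale0r addr0 => /(_ df) dfy.
have E : \forall s \near (0 : R), f (y + s *: y) = f y + s * f y.
  near=> s.
  have s1 : -1 < s by near: s; apply: lt_nbhsr; rewrite ltrN10.
  rewrite -{1}(scale1r y) -scalerDl fh ?mulrDl ?mul1r//.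
  by rewrite -ltrBlDl sub0r.
have := near_eq_is_derive E dfy => -[_ <-].
have [_ H] := is_deriveD (is_derive_cst (f y) (0 : R) (1 : R))
  (is_deriveM (is_derive_id (0 : R) (1 : R))
    (is_derive_cst (f y) (0 : R) (1 : R))).
by rewrite -[RHS]add0r [LHS]H scaler0 !add0r; exact: mulr1.
Unshelve. all: by end_near. Qed.

Lemma derive_kernel {R : realType} {N} (f : 'rV[R]_N -> R) y :
  (1 < N)%N -> differentiable f y -> exists2 v : 'rV[R]_N, v != 0 & 'D_v f y = 0.
Proof.
move=> hN df; pose i : 'I_N := Ordinal (ltnW hN); pose j : 'I_N := Ordinal hN.
have b0 l : basis_vec (R := R) l != 0 :> 'rV[R]_N.
  by apply/eqP => /rowP/(_ l)/eqP; rewrite !mxE !eqxx oner_eq0.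
have [Di|Di] := eqVneq ('D_(basis_vec i) f y) 0; first by exists (basis_vec i).
exists (- 'D_(basis_vec j) f y *: basis_vec i
  + 'D_(basis_vec i) f y *: basis_vec j).
  apply: contraNneq Di => /rowP/(_ j); rewrite !mxE !eqxx/= => /eqP.
  by rewrite mulr0 add0r mulr1.
by rewrite (derive_comb _ _ _ _ df) /GRing.scale/=; ring.
Qed.

(** * Inner products *)

Section InnerProduct.
Context {R : realType} {N : nat}.
Implicit Types (A : 'M[R]_N) (u v w : 'rV[R]_N).

Definition dot A u v : R := \sum_m \sum_n A m n * u 0 m * v 0 n.

Lemma dotE A u v : dot A u v = (u *m A *m v^T) 0 0.
Proof.
rewrite /dot exchange_big mxE; apply: eq_bigr => n _.
rewrite !mxE mulr_suml; apply: eq_bigr => m _.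
by rewrite [A m n * _]mulrC.
Qed.

Lemma dotDl A u v w : dot A (u + v) w = dot A u w + dot A v w.
Proof. by rewrite !dotE !mulmxDl mxE. Qed.

Lemma dotZl A c u v : dot A (c *: u) v = c * dot A u v.
Proof. by rewrite !dotE -!scalemxAl mxE. Qed.

Lemma dot0l A v : dot A 0 v = 0.
Proof. by rewrite -[X in dot A X v](scale0r v) dotZl mul0r. Qed.

Lemma dot_suml A (I : finType) (X : I -> 'rV[R]_N) w :
  dot A (\sum_i X i) w = \sum_i dot A (X i) w.
Proof. by apply: (big_morph (dot A ^~ w)) => [u v|]; rewrite ?dotDl ?dot0l. Qed.

Definition nrm A u := Num.sqrt (dot A u u).

Lemma is_derive_dot A (c d : R -> 'rV[R]_N) (t : R) c' d' :
  is_derive t (1 : R) c c' -> is_derive t (1 : R) d d' ->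
  is_derive t (1 : R) (fun s => dot A (c s) (d s))
    (dot A c' (d t) + dot A (c t) d').
Proof.
move=> dc dd.
have -> : (fun s => dot A (c s) (d s)) =
    \sum_m \sum_n (fun s => A m n * c s 0 m * d s 0 n).
  by apply/funext => s; rewrite fct_sumE; apply: eq_bigr => m _; rewrite fct_sumE.
have dcoord m n : is_derive t (1 : R) (fun s => A m n * c s 0 m * d s 0 n)
    (A m n * c' 0 m * d t 0 n + A m n * c t 0 m * d' 0 n).
  have dcm : is_derive t (1 : R) (fun s => c s 0 m) (c' 0 m).
    exact: is_derive_coord.
  have ddn : is_derive t (1 : R) (fun s => d s 0 n) (d' 0 n).
    exact: is_derive_coord.
  apply: (is_derive_eq (is_deriveM
    (is_deriveM (is_derive_cst (A m n) t (1 : R)) dcm) ddn)).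
  by rewrite -[(cst _ * _) t]/(A m n * c t 0 m) /GRing.scale/=; ring.
have -> : dot A c' (d t) + dot A (c t) d' =
    \sum_m \sum_n (A m n * c' 0 m * d t 0 n + A m n * c t 0 m * d' 0 n).
  by rewrite /dot -big_split; apply: eq_bigr => m _; rewrite -big_split.
by apply: is_derive_sum => m; exact: is_derive_sum.
Qed.

Section PositiveDefinite.
Variable A : 'M[R]_N.
Hypothesis Asym : forall m n, A m n = A n m.
Hypothesis Apos : forall v, v != 0 -> 0 < dot A v v.

Lemma dotC u v : dot A u v = dot A v u.
Proof.
rewrite /dot exchange_big; apply: eq_bigr => m _; apply: eq_bigr => n _.
by rewrite (Asym n m) mulrAC.
Qed.

Lemma dotDr u v w : dot A u (v + w) = dot A u v + dot A u w.
Proof. by rewrite dotC dotDl !(dotC u). Qed.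

Lemma dotZr c u v : dot A u (c *: v) = c * dot A u v.
Proof. by rewrite dotC dotZl dotC. Qed.

Lemma dot_ge0 u : 0 <= dot A u u.
Proof.
have [->|/Apos/ltW//] := eqVneq u 0.
by rewrite dot0l.
Qed.

Lemma sqr_nrm u : nrm A u ^+ 2 = dot A u u.
Proof. by rewrite sqr_sqrtr// dot_ge0. Qed.

Lemma nrm_ge0 u : 0 <= nrm A u. Proof. exact: sqrtr_ge0. Qed.

Lemma nrm_gt0 u : u != 0 -> 0 < nrm A u.
Proof. by move=> /Apos; rewrite sqrtr_gt0. Qed.

Lemma nrm0 : nrm A 0 = 0.
Proof. by rewrite /nrm dot0l sqrtr0. Qed.

Lemma nrmZ c u : 0 <= c -> nrm A (c *: u) = c * nrm A u.
Proof.
move=> c0; rewrite /nrm dotZl dotZr mulrA -expr2 sqrtrM ?sqr_ge0//.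
by rewrite sqrtr_sqr ger0_norm.
Qed.

Lemma dot_eq0 u : dot A u u = 0 -> u = 0.
Proof.
by move=> u0; apply/eqP; apply: contraT => /Apos; rewrite u0 ltxx.
Qed.

Lemma Cauchy_Schwarz u v : `|dot A u v| <= nrm A u * nrm A v.
Proof.
have [->|v0] := eqVneq v 0.
  by rewrite nrm0 mulr0 dotC dot0l normr0.
rewrite -(@ler_pXn2r _ 2) ?nnegrE ?normr_ge0 ?mulr_ge0 ?nrm_ge0//.
rewrite exprMn !sqr_nrm real_normK ?num_real//.
(* (v, v) times the component of u orthogonal to v *)
have := dot_ge0 (dot A v v *: u + (- dot A u v) *: v).
rewrite !(dotDl, dotDr, dotZl, dotZr) (dotC v u).
have := Apos v0; set a := dot A u u; set b := dot A u v; set c := dot A v v.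
move=> c0 H; have : 0 <= c * (a * c - b ^+ 2).
  apply: le_trans H _; rewrite le_eqVlt; apply/orP; left; apply/eqP; ring.
by rewrite pmulr_rge0// subr_ge0.
Qed.

Lemma is_derive_nrm (c : R -> 'rV[R]_N) (t : R) c' :
  c t != 0 -> is_derive t (1 : R) c c' ->
  is_derive t (1 : R) (fun s => nrm A (c s)) (dot A (c t) c' / nrm A (c t)).
Proof.
move=> ct0 dc; have d2 := is_derive_dot A dc dc.
have ds := is_derive1_sqrt (Apos ct0).
have := is_derive1_comp ds d2.
rewrite (dotC c') => H; apply: is_derive_eq H _.
by rewrite /nrm; field; rewrite gt_eqF// -/(nrm A (c t)) nrm_gt0.
Qed.

Lemma continuous_nrm : continuous (nrm A).
Proof.
move=> u; apply: (@continuous_comp _ _ _ (fun u => dot A u u) Num.sqrt); last first.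
  exact: sqrt_continuous.
apply: (@cvg_big _ _ _ _ _ _ _ _ _ _ _ (nbhs_filter u)) => [|m _].
  exact: add_continuous.
apply: (@cvg_big _ _ _ _ _ _ _ _ _ _ _ (nbhs_filter u)) => [|n _].
  exact: add_continuous.
apply: cvgM; last exact: coord_continuous.
apply: cvgMl_tmp; exact: coord_continuous.
Qed.

End PositiveDefinite.
End InnerProduct.

(** * One tangent space *)

(** X and Y stand for the squared norms of D_v Z at s u and at u. *)
Lemma square_proportion {R : realFieldType} (p q v w s X Y : R) :
  0 < p -> 0 < q -> 0 < v -> 0 < w -> 0 < s -> 0 < Y ->
  (p * s) ^+ 2 * X = q ^+ 2 * Y -> w ^+ 2 * X = v ^+ 2 * Y ->
  s * (p * v) = q * w.
Proof.
move=> p0 q0 v0 w0 s0 Y0 E1 E2; apply/eqP; rewrite -(@eqrXn2 _ 2)//; last 2 first.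
- by rewrite !mulr_ge0// ltW.
- by rewrite mulr_ge0// ltW.
apply/eqP/(mulIf (lt0r_neq0 Y0)).
transitivity ((p * s) ^+ 2 * (v ^+ 2 * Y)); first by ring.
rewrite -E2; transitivity (w ^+ 2 * ((p * s) ^+ 2 * X)); first by ring.
by rewrite E1; ring.
Qed.

(** What a conformal isomorphism provides in one tangent space, with A = a(x)
    and the conformal multiplier written as vk(K).  The metric tensor g is
    eliminated in favour of vk(K)^2 Z^* A: [fib_radial] is the identity
    g_y(y, v) = K(y) dK_y(v), and [fib_scale] is g_(sy)(v, v) = g_y(v, v). *)
Record conformal_fibre {R : realType} {N : nat} (K : 'rV[R]_N -> R)
    (A : 'M[R]_N) (T Z : 'rV[R]_N -> 'rV[R]_N) (vk : R -> R) : Prop := {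
  fib_K0 : K 0 = 0;
  fib_K_gt0 : forall y, y != 0 -> 0 < K y;
  fib_Kh : forall y c, 0 < c -> K (c *: y) = c * K y;
  fib_cK : continuous K;
  fib_dK : forall y, y != 0 -> differentiable K y;
  fib_sym : forall m n, A m n = A n m;
  fib_pos : forall v, v != 0 -> 0 < dot A v v;
  fib_TK : cancel T Z;
  fib_ZK : cancel Z T;
  fib_T0 : T 0 = 0;
  fib_cT : continuous T;
  fib_cZ : continuous Z;
  fib_dT : forall v, v != 0 -> differentiable T v;
  fib_dZ : forall y, y != 0 -> differentiable Z y;
  fib_vk : forall s, 0 < s -> 0 < vk s;
  fib_radial : forall y v, y != 0 ->
    vk (K y) ^+ 2 * dot A ('D_y Z y) ('D_v Z y) = K y * 'D_v K y;
  fib_scale : forall y v s, y != 0 -> 0 < s ->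
    vk (K (s *: y)) ^+ 2 * dot A ('D_v Z (s *: y)) ('D_v Z (s *: y)) =
    vk (K y) ^+ 2 * dot A ('D_v Z y) ('D_v Z y) }.

Section Fibre.
Context {R : realType} {N : nat} {K : 'rV[R]_N -> R} {A : 'M[R]_N}.
Context {T Z : 'rV[R]_N -> 'rV[R]_N} {vk : R -> R}.
Hypothesis F : conformal_fibre K A T Z vk.

Implicit Types (u v y z : 'rV[R]_N) (s : R).

Let sym := fib_sym F.
Let pos := fib_pos F.

Lemma ray_neq0 y s : y != 0 -> 0 < s -> s *: y != 0.
Proof. by move=> y0 s0; rewrite scaler_eq0 negb_or gt_eqF. Qed.

Lemma unit_neq0 u : K u = 1 -> u != 0.
Proof. by apply: contra_eq_neq => ->; rewrite (fib_K0 F) eq_sym oner_eq0. Qed.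

Lemma fib_Z0 : Z 0 = 0.
Proof. by rewrite -{1}(fib_T0 F) (fib_TK F). Qed.

Lemma fib_Z_neq0 y : y != 0 -> Z y != 0.
Proof. by apply: contraNneq => Zy; rewrite -(fib_ZK F y) Zy (fib_T0 F). Qed.

Lemma fib_T_neq0 v : v != 0 -> T v != 0.
Proof. by apply: contraNneq => Tv; rewrite -(fib_TK F v) Tv fib_Z0. Qed.

(** [fib_radial] for v = y, where dK_y(y) = K(y). *)
Lemma radial_speed y : y != 0 -> nrm A ('D_y Z y) = K y / vk (K y).
Proof.
move=> y0; have Ky := fib_K_gt0 F y0; have vy := fib_vk F Ky.
have := fib_radial F y y0; rewrite Euler_homogeneous; last 2 first.
- by move=> c c0; exact: fib_Kh F _ _ c0.
- exact: fib_dK F _ y0.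
rewrite /nrm => E.
have -> : dot A ('D_y Z y) ('D_y Z y) = (K y / vk (K y)) ^+ 2.
  apply: (mulfI (_ : vk (K y) ^+ 2 != 0)); first by rewrite sqrf_eq0 gt_eqF.
  by rewrite E; field; rewrite gt_eqF.
by rewrite sqrtr_sqr ger0_norm// divr_ge0// ltW.
Qed.

(** Cauchy-Schwarz in [fib_radial]: the gradient of K has length one for g. *)
Lemma dK_bound y v : y != 0 -> `|'D_v K y| <= vk (K y) * nrm A ('D_v Z y).
Proof.
move=> y0; have Ky := fib_K_gt0 F y0; have vy := fib_vk F Ky.
rewrite -(@ler_pM2l _ (K y))// -{1}(gtr0_norm Ky) -normrM -(fib_radial F)//.
rewrite normrM (@ger0_norm _ (_ ^+ 2)) ?sqr_ge0//.
apply: (@le_trans _ _ (vk (K y) ^+ 2 * (nrm A ('D_y Z y) * nrm A ('D_v Z y)))).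
  by rewrite ler_wpM2l ?sqr_ge0//; exact: Cauchy_Schwarz.
rewrite (radial_speed y0) le_eqVlt; apply/orP; left; apply/eqP.
by field; rewrite gt_eqF.
Qed.

Lemma is_derive_Z_ray y s : y != 0 -> 0 < s ->
  is_derive s (1 : R) (fun s : R => Z (s *: y)) ('D_y Z (s *: y)).
Proof.
move=> y0 s0; apply: is_derive_comp_curve.
  exact/(fib_dZ F)/ray_neq0.
exact: is_derive_ray.
Qed.

Lemma ray_speed y s : y != 0 -> 0 < s ->
  nrm A ('D_y Z (s *: y)) = K y / vk (s * K y).
Proof.
move=> y0 s0; have sy0 := ray_neq0 y0 s0.
apply: (mulfI (_ : s != 0)); first by rewrite gt_eqF.
rewrite -nrmZ ?(ltW s0)// mulrA -(fib_Kh F)// -radial_speed//.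
rewrite -[s *: 'D_y Z _]addr0 -(scale0r ('D_y Z (s *: y))).
by rewrite -derive_comb ?scale0r ?addr0//; exact: fib_dZ F _ sy0.
Qed.

(** P_y; [dprofile y] gives its derivative away from 0. *)
Definition profile y s := nrm A (Z (s *: y)).

Definition dprofile y s :=
  dot A (Z (s *: y)) ('D_y Z (s *: y)) / profile y s.

Lemma is_derive_profile y s : y != 0 -> 0 < s ->
  is_derive s (1 : R) (profile y) (dprofile y s).
Proof.
move=> y0 s0; apply: is_derive_nrm => //; last exact: is_derive_Z_ray.
exact/fib_Z_neq0/ray_neq0.
Qed.

Lemma profile_gt0 y s : y != 0 -> 0 < s -> 0 < profile y s.
Proof.
move=> y0 s0; apply: nrm_gt0 => //.
exact/fib_Z_neq0/ray_neq0.
Qed.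

Lemma dprofile_bound y s : y != 0 -> 0 < s ->
  `|dprofile y s| <= K y / vk (s * K y).
Proof.
move=> y0 s0; have P := profile_gt0 y0 s0.
rewrite /dprofile normrM normfV (gtr0_norm P) ler_pdivrMr// mulrC -ray_speed//.
exact: Cauchy_Schwarz.
Qed.

Lemma continuous_profile y : continuous (profile y).
Proof.
move=> s; apply: (@continuous_comp _ _ _ (fun s : R => Z (s *: y)) (nrm A)).
  apply: (@continuous_comp _ _ _ (fun s : R => s *: y) Z).
    exact: scalel_continuous.
  exact: (fib_cZ F).
exact: continuous_nrm.
Qed.

Lemma profile0 y : profile y 0 = 0.
Proof. by rewrite /profile scale0r fib_Z0 nrm0. Qed.

(** The function c(s) that is compared with P_u, for zeta = z; [dheight z]
    gives its derivative away from 0. *)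
Definition height z s := K (T (s *: z)).
Definition dheight z s := 'D_('D_z T (s *: z)) K (T (s *: z)).

Lemma is_derive_height z s : z != 0 -> 0 < s ->
  is_derive s (1 : R) (height z) (dheight z s).
Proof.
move=> z0 s0; have sz0 := ray_neq0 z0 s0.
apply: (@is_derive_comp_curve _ _ _ K (fun s : R => T (s *: z))).
  exact/(fib_dK F)/fib_T_neq0.
apply: is_derive_comp_curve; first exact: (fib_dT F).
exact: is_derive_ray.
Qed.

Lemma height_gt0 z s : z != 0 -> 0 < s -> 0 < height z s.
Proof.
by move=> z0 s0; exact/(fib_K_gt0 F)/fib_T_neq0/ray_neq0.
Qed.

Lemma continuous_height z : continuous (height z).
Proof.
move=> s; apply: (@continuous_comp _ _ _ (fun s : R => T (s *: z)) K).
  apply: (@continuous_comp _ _ _ (fun s : R => s *: z) T).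
    exact: scalel_continuous.
  exact: (fib_cT F).
exact: (fib_cK F).
Qed.

Lemma height0 z : height z 0 = 0.
Proof. by rewrite /height scale0r (fib_T0 F) (fib_K0 F). Qed.

Lemma height1 y : height (Z y) 1 = K y.
Proof. by rewrite /height scale1r (fib_ZK F). Qed.

Lemma dheight_bound z s : z != 0 -> 0 < s ->
  `|dheight z s| <= vk (height z s) * nrm A z.
Proof.
move=> z0 s0; have sz0 := ray_neq0 z0 s0.
have E : 'D_('D_z T (s *: z)) Z (T (s *: z)) = z.
  have dT : is_derive s (1 : R) (fun s : R => T (s *: z)) ('D_z T (s *: z)).
    by apply: is_derive_comp_curve (is_derive_ray z s); exact: (fib_dT F).
  have [_ <-] := is_derive_comp_curve (fib_dZ F (fib_T_neq0 sz0)) dT.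
  under eq_fun do rewrite (fib_TK F).
  by have [_ ->] := is_derive_ray z s.
by have := dK_bound ('D_z T (s *: z)) (fib_T_neq0 sz0); rewrite E.
Qed.

(** The bounds on the derivatives of [profile y] and [height z] involve
    reciprocal values of vk, so they cancel in the composite, which starts
    at 0 and therefore grows by at most |z| on [0, 1].  The vectors y and z
    are unrelated; this is what makes the next lemma possible. *)
Lemma profile_height_le y z : K y = 1 -> z != 0 ->
  profile y (height z 1) <= nrm A z.
Proof.
move=> Ky z0; have y0 := unit_neq0 Ky.
have d s : s \in `]0, 1[%R -> is_derive s (1 : R) (profile y \o height z)
    (dprofile y (height z s) * dheight z s).
  rewrite in_itv/= => /andP[s0 _].
  have d1 := is_derive_profile y0 (height_gt0 z0 s0).
  have d2 := is_derive_height z0 s0.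
  exact: is_derive1_comp.
have [|c c01] := @MVT R _ _ 0 1 ltr01 d.
  apply: continuous_subspaceT => s; apply: continuous_comp.
    exact: continuous_height.
  exact: continuous_profile.
rewrite /= height0 profile0 !subr0 mulr1 => ->.
move: c01; rewrite in_itv/= => /andP[c0 _].
apply: le_trans (ler_norm _) _; rewrite normrM.
have h0 := height_gt0 z0 c0; have v0 := fib_vk F h0.
apply: le_trans (ler_pM _ _ (dprofile_bound y0 h0) (dheight_bound z0 c0)) _ => //.
by rewrite Ky mulr1 mul1r mulrA mulVf ?gt_eqF// mul1r.
Qed.

(** With w the unit vector on the ray of y, [profile_height_le] applied to the
    pairs (u, Z y) and (w, Z (K(y) u)) bounds each side by the other. *)
Lemma nrm_Z_profile u y : K u = 1 -> nrm A (Z y) = profile u (K y).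
Proof.
move=> Ku; have u0 := unit_neq0 Ku.
have [->|y0] := eqVneq y 0; first by rewrite fib_Z0 nrm0 (fib_K0 F) profile0.
have Ky := fib_K_gt0 F y0.
apply/eqP; rewrite eq_le; apply/andP; split; last first.
  by rewrite -(height1 y); apply: profile_height_le => //; exact: fib_Z_neq0.
pose w := (K y)^-1 *: y.
have Kw : K w = 1 by rewrite (fib_Kh F) ?invr_gt0// mulVf// gt_eqF.
have Ku0 := ray_neq0 u0 Ky.
have := profile_height_le Kw (fib_Z_neq0 Ku0).
rewrite height1 (fib_Kh F)// Ku mulr1 /profile /w scalerA mulfV ?gt_eqF//.
by rewrite scale1r.
Qed.

(** Along z = Z (s u) one has [profile u (height z t)] = t |z|; differentiated at
    t = 1, this leaves no room in the two derivative bounds. *)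
Lemma norm_dprofile u s : K u = 1 -> 0 < s -> `|dprofile u s| = (vk s)^-1.
Proof.
move=> Ku; have u0 := unit_neq0 Ku; move=> s0; have vs := fib_vk F s0.
apply/eqP; rewrite eq_le; apply/andP; split.
  by have := dprofile_bound u0 s0; rewrite Ku mulr1 mul1r.
pose z := Z (s *: u).
have z0 : z != 0 by apply: fib_Z_neq0; exact: ray_neq0.
have h1 : height z 1 = s by rewrite height1 (fib_Kh F)// Ku mulr1.
have E : dprofile u s * dheight z 1 = nrm A z.
  have dh := is_derive_height z0 ltr01.
  have dP : is_derive (height z 1) (1 : R) (profile u) (dprofile u s).
    by rewrite h1; exact: is_derive_profile.
  have [_ <-] := is_derive1_comp dP dh.
  have near_id : \forall t \near (1 : R),
      (profile u \o height z) t = t * nrm A z.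
    near=> t.
    have t0 : 0 < t by near: t; exact: lt_nbhsr.
    by rewrite /= /height -(nrm_Z_profile _ Ku) (fib_TK F) nrmZ// ltW.
  rewrite (near_eq_derive _ near_id).
  have [_ H] := is_deriveM (is_derive_id (1 : R) (1 : R))
    (is_derive_cst (nrm A z) (1 : R) (1 : R)).
  by rewrite [LHS]H scaler0 add0r; exact: mulr1.
have zpos : 0 < nrm A z by exact: nrm_gt0.
rewrite -[leLHS]mul1r ler_pdivrMr// -(@ler_pM2r _ (nrm A z))// mul1r -mulrA.
rewrite -{1}E (le_trans (ler_norm _))// normrM ler_wpM2l//.
by have := dheight_bound z0 ltr01; rewrite h1.
Unshelve. all: by end_near. Qed.

Lemma profile_inj u : K u = 1 -> {in `[0, +oo[%R &, injective (profile u)}.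
Proof.
move=> Ku; have u0 := unit_neq0 Ku; move=> s t; rewrite !in_itv/= !andbT.
wlog st : s t / s <= t.
  move=> W s0 t0 E; have [st|ts] := leP s t; first exact: W.
  by symmetry; apply: W => //; exact: ltW.
move=> s0 _ E; apply/eqP/negPn/negP => nst.
have lt_st : s < t by rewrite lt_neqAle nst.
have [x||x] := @MVT R (profile u) (dprofile u) s t lt_st.
- rewrite in_itv/= => /andP[sx _].
  by apply: (is_derive_profile u0); exact: le_lt_trans sx.
- by apply: continuous_subspaceT => x; exact: continuous_profile.
rewrite in_itv/= => /andP[sx _]; rewrite E subrr => /esym/eqP.
have x0 := le_lt_trans s0 sx.
rewrite mulf_eq0 subr_eq0 (gt_eqF lt_st) orbF -normr_eq0 (norm_dprofile Ku)//.
by rewrite invr_eq0 gt_eqF// (fib_vk F).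
Qed.

(** Being injective, P_u is monotone, and increasing since P_u(0) = 0 < P_u(1);
    this removes the absolute value. *)
Lemma dprofileE u s : K u = 1 -> 0 < s -> dprofile u s = (vk s)^-1.
Proof.
move=> Ku; have u0 := unit_neq0 Ku; move=> s0; rewrite -(norm_dprofile Ku)// ger0_norm//.
have Pc : {within [set` `[0, +oo[%R], continuous (profile u)}.
  by apply: continuous_subspaceT => x; exact: continuous_profile.
have Pmono : {in `[0, +oo[%R &, {mono profile u : x y / x <= y}}.
  apply: itv_continuous_inj_le => //; last exact: profile_inj Ku.
  exists 0, 1; rewrite !in_itv/= ltr01 lexx ler01; split=> //.
  by rewrite profile0 ltW// profile_gt0.
have [_ <-] := is_derive_profile u0 s0.
rewrite -derive1E; apply: (@incr_derive1_ge0_itvy R (profile u) true 0).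
- move=> x; rewrite inE/= in_itv/= andbT => x0.
  by have [] := is_derive_profile u0 x0.
- by move=> x y xI yI xy; rewrite (leW_mono_in Pmono).
- by rewrite in_itv/= s0.
Qed.

Lemma is_derive_profile_vk u s : K u = 1 -> 0 < s ->
  is_derive s (1 : R) (profile u) (vk s)^-1.
Proof.
move=> Ku s0; rewrite -(dprofileE Ku)//.
exact: (is_derive_profile (unit_neq0 Ku)).
Qed.

(** The curve c(t) = Z (t u) satisfies c . c' = P P' and |c'| = P', the equality
    case of Cauchy-Schwarz; hence c' is (P' / P) c and c / P is constant. *)
Lemma Z_ray u s : K u = 1 -> 0 < s -> profile u 1 *: Z (s *: u) = profile u s *: Z u.
Proof.
move=> Ku; have u0 := unit_neq0 Ku; move=> s0; apply/rowP => i; rewrite !mxE.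
pose f t := Z (t *: u) 0 i / profile u t.
have df (t : R) : 0 < t -> is_derive t (1 : R) f 0.
  move=> t0; have Pt := profile_gt0 u0 t0.
  pose c := Z (t *: u); pose c' := 'D_u Z (t *: u).
  have E : c' = (dprofile u t / profile u t) *: c.
    apply/subr0_eq/(dot_eq0 pos).
    have cc' : dot A c c' = profile u t * dprofile u t.
      by rewrite /dprofile mulrC divfK// gt_eqF.
    have c'c' : dot A c' c' = dprofile u t ^+ 2.
      by rewrite -sqr_nrm// (ray_speed u0 t0) Ku mulr1 mul1r dprofileE.
    have cc : dot A c c = profile u t ^+ 2 by rewrite -sqr_nrm.
    rewrite -scaleNr !(dotDl, dotDr sym, dotZl, dotZr sym) (dotC sym c' c).
    by rewrite cc' c'c' cc; field; rewrite gt_eqF.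
  have dc : is_derive t (1 : R) (fun t : R => Z (t *: u) 0 i) (c' 0 i).
    by apply: is_derive_coord; exact: (is_derive_Z_ray u0).
  have dP := is_derive_profile u0 t0.
  have dV := is_deriveV (lt0r_neq0 Pt) dP.
  apply: (is_derive_eq (is_deriveM dc dV)).
  by rewrite E !mxE /GRing.scale/=; field; rewrite gt_eqF.
have := derive0_pos_cst df s0 ltr01; rewrite /f scale1r.
have Ps := profile_gt0 u0 s0; have P1 := profile_gt0 u0 ltr01.
move=> /eqP; rewrite (eqr_div _ _ (lt0r_neq0 Ps) (lt0r_neq0 P1)) => /eqP E.
by rewrite mulrC E; exact: mulrC.
Qed.

(** [Z_ray] transported to an arbitrary ray, whose profile is that of u; the
    form without quotients can be differentiated in y. *)
Lemma Z_homothety u y s : K u = 1 -> 0 < s ->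
  profile u (K y) *: Z (s *: y) = profile u (s * K y) *: Z y.
Proof.
move=> Ku; have u0 := unit_neq0 Ku; move=> s0; have [->|y0] := eqVneq y 0.
  by rewrite scaler0 fib_Z0 !scaler0.
have Ky := fib_K_gt0 F y0.
pose w := (K y)^-1 *: y.
have Kw : K w = 1 by rewrite (fib_Kh F) ?invr_gt0// mulVf// gt_eqF.
have yE : y = K y *: w by rewrite /w scalerA mulfV ?gt_eqF// scale1r.
have PE r : 0 < r -> profile w r = profile u r.
  move=> r0; rewrite -[r in RHS]mulr1 -Kw -(fib_Kh F)//.
  exact: nrm_Z_profile.
have H r : 0 < r -> profile u 1 *: Z (r *: w) = profile u r *: Z w.
  by move=> r0; rewrite -!PE//; exact: (Z_ray Kw).
have P1 := profile_gt0 u0 ltr01.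
apply: (scalerI (lt0r_neq0 P1)).
have H1 : profile u 1 *: Z (s *: y) = profile u (s * K y) *: Z w.
  by rewrite [in LHS]yE scalerA H// mulr_gt0.
have H2 : profile u 1 *: Z y = profile u (K y) *: Z w by rewrite [in LHS]yE H.
rewrite [LHS]scalerA mulrC -scalerA H1 [RHS]scalerA [in RHS]mulrC -scalerA H2.
by rewrite !scalerA mulrC.
Qed.

Lemma Z_immersion u v : u != 0 -> v != 0 -> 'D_v Z u != 0.
Proof.
move=> u0; apply: contraNneq => Dv.
have dZ : is_derive (0 : R) (1 : R) (fun s : R => Z (u + s *: v)) ('D_v Z u).
  rewrite -{2}[u]addr0 -(scale0r v).
  apply: is_derive_comp_curve; last exact: is_derive_affine.
  by rewrite scale0r addr0; exact: (fib_dZ F).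
have dT : differentiable T (Z (u + 0 *: v)).
  by rewrite scale0r addr0; exact/(fib_dT F)/fib_Z_neq0.
have [_] := is_derive_comp_curve dT dZ.
under eq_fun do rewrite (fib_ZK F).
have [_ ->] := is_derive_affine u v 0.
by rewrite Dv derive0 => ->.
Qed.

(** On both sides of [Z_homothety] only the factor Z varies to first order when
    y leaves u in the direction v, so
    P_u(1) s D_v Z (s u) = P_u(s) D_v Z (u).  By [fib_scale] the norms of these
    two derivatives are also in the ratio vk(1) : vk(s). *)
Lemma profile_vk_linear u v s : K u = 1 -> v != 0 -> 'D_v K u = 0 -> 0 < s ->
  s * (profile u 1 * vk 1) = profile u s * vk s.
Proof.
move=> Ku; have u0 := unit_neq0 Ku; move=> v0 Dv s0.
have P1 := profile_gt0 u0 ltr01; have Ps := profile_gt0 u0 s0.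
have v1 := fib_vk F ltr01; have vs := fib_vk F s0.
pose c t : 'rV[R]_N := u + t *: v.
have c0 : c 0 = u by rewrite /c scale0r addr0.
have dc : is_derive (0 : R) (1 : R) c v by exact: is_derive_affine.
have dK : is_derive (0 : R) (1 : R) (fun t => K (c t)) 0.
  have dKc : differentiable K (c 0) by rewrite c0; exact: (fib_dK F).
  by have := is_derive_comp_curve dKc dc; rewrite c0 Dv.
have dsc : is_derive (0 : R) (1 : R) (fun t => s *: c t) (s *: v).
  exact: is_deriveZ.
have dZ i : is_derive (0 : R) (1 : R) (fun t => Z (c t) 0 i) ('D_v Z u 0 i).
  have dZc : differentiable Z (c 0) by rewrite c0; exact: (fib_dZ F).
  have := is_derive_coord i (is_derive_comp_curve dZc dc).
  by rewrite c0.
have dZs i : is_derive (0 : R) (1 : R) (fun t => Z (s *: c t) 0 i)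
    (s * 'D_v Z (s *: u) 0 i).
  have dZu : differentiable Z (s *: u) by apply: (fib_dZ F); exact: ray_neq0.
  have dZc : differentiable Z (s *: c 0) by rewrite c0.
  have := is_derive_coord i (is_derive_comp_curve dZc dsc).
  by rewrite c0 !deriveE// linearZ mxE.
have dPK (r : R) : 0 < r ->
    is_derive (0 : R) (1 : R) (fun t => profile u (r * K (c t))) 0.
  move=> r0.
  have dr : is_derive (0 : R) (1 : R) (fun t => r * K (c t)) 0.
    by rewrite -[X in is_derive _ _ _ X](scaler0 _ r); exact: is_deriveZ.
  have dP : is_derive (r * K (c 0)) (1 : R) (profile u) (dprofile u (r * K (c 0))).
    by apply: (is_derive_profile u0); rewrite c0 Ku mulr1.
  have := @is_derive1_comp _ (profile u) (fun t => r * K (c t)) 0 _ _ dP dr.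
  by rewrite mulr0.
have E : (profile u 1 * s) *: 'D_v Z (s *: u) = profile u s *: 'D_v Z u.
  apply/rowP => i; rewrite !mxE.
  have d1 := is_deriveM (dPK 1 ltr01) (dZs i).
  have d2 := is_deriveM (dPK s s0) (dZ i).
  have Efun : (fun t => profile u (1 * K (c t))) * (fun t => Z (s *: c t) 0 i) =
      (fun t => profile u (s * K (c t))) * (fun t => Z (c t) 0 i).
    apply/funext => t.
    have H : profile u (1 * K (c t)) * Z (s *: c t) 0 i =
        profile u (s * K (c t)) * Z (c t) 0 i.
      by have /rowP/(_ i) := Z_homothety (c t) Ku s0; rewrite !mxE mul1r.
    exact: H.
  move: d1; rewrite Efun => -[_ E1]; move: d2 => [_]; rewrite E1.
  rewrite c0 Ku !mulr1 !scaler0 !addr0 /GRing.scale/= => <-.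
  by rewrite mulrA.
have X := fib_scale F v u0 s0; rewrite (fib_Kh F _ s0) Ku mulr1 in X.
have Y : 0 < dot A ('D_v Z u) ('D_v Z u) by apply: pos; exact: Z_immersion.
have E2 : (profile u 1 * s) ^+ 2 * dot A ('D_v Z (s *: u)) ('D_v Z (s *: u)) =
    profile u s ^+ 2 * dot A ('D_v Z u) ('D_v Z u).
  have := congr1 (fun w => dot A w w) E.
  rewrite dotZl (dotZr sym) dotZl (dotZr sym) => H.
  by rewrite expr2 -[LHS]mulrA [LHS]H; ring.
exact: (square_proportion P1 Ps v1 vs s0 Y E2 X).
Qed.

(** Both sides have the same derivative and tend to 0 with s. *)
Lemma profile_of_multiplier u h s : K u = 1 -> 0 < h ->
  (forall t, 0 < t -> vk t = h^-1 * t `^ (1 - h)) -> 0 < s -> profile u s = s `^ h.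
Proof.
move=> Ku; have u0 := unit_neq0 Ku; move=> h0 vkE s0.
pose f t := profile u t - t `^ h.
have df (t : R) : 0 < t -> is_derive t (1 : R) f 0.
  move=> t0; have dP := is_derive_profile_vk Ku t0.
  have dp := is_derive1_powR h t0.
  apply: (is_derive_eq (is_deriveB dP dp)); rewrite vkE// invfM invrK -powRN.
  by rewrite opprB subrr.
have fE t : 0 < t -> f t = f s by move=> t0; exact: (derive0_pos_cst df).
have cf : f t @[t --> 0^'+] --> (0 : R).
  rewrite -[X in _ --> X](subrr 0); apply: cvgB; last exact: powR_cvg0.
  have P0 : profile u t @[t --> (0 : R)^'+] --> profile u 0.
    by apply: cvg_at_right_filter; exact: continuous_profile.
  by rewrite profile0 in P0.
have cs : f t @[t --> 0^'+] --> f s.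
  apply: cvg_near_cst; near=> t; apply: fE; near: t; exact: nbhs_right_gt.
by apply/eqP; rewrite -subr_eq0; apply/eqP; exact: (cvg_unique _ cs cf).
Unshelve. all: by end_near. Qed.

(** Here h = 1 / vk(1), and P_u(1) = 1 because u goes to a unit vector.  By
    [profile_vk_linear] the equation P_u' = 1 / vk becomes P_u' = h P_u / s, so
    that P_u(s) s^(-h) is constant. *)
Lemma multiplier_of_unit u v s : K u = 1 -> v != 0 -> 'D_v K u = 0 ->
  nrm A (Z u) = 1 -> 0 < s -> vk s = ((vk 1)^-1)^-1 * s `^ (1 - (vk 1)^-1).
Proof.
move=> Ku; have u0 := unit_neq0 Ku; move=> v0 Dv Zu s0.
have v1 := fib_vk F ltr01; set h := (vk 1)^-1.
have h0 : 0 < h by rewrite invr_gt0.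
have P1 : profile u 1 = 1 by rewrite /profile scale1r.
have lin t : 0 < t -> vk t = t / (h * profile u t).
  move=> t0; have Pt := profile_gt0 u0 t0.
  have := profile_vk_linear Ku v0 Dv t0; rewrite P1 mul1r => E.
  rewrite /h; apply: (mulfI (lt0r_neq0 Pt)); rewrite -E.
  by field; rewrite !gt_eqF.
have PE t : 0 < t -> profile u t = t `^ h.
  move=> t0; pose f r := profile u r * r `^ (- h).
  have df (r : R) : 0 < r -> is_derive r (1 : R) f 0.
    move=> r0; have dP := is_derive_profile_vk Ku r0.
    have dp := is_derive1_powR (- h) r0.
    have Pr := profile_gt0 u0 r0.
    apply: (is_derive_eq (is_deriveM dP dp)); rewrite lin// /GRing.scale/=.
    rewrite powRB ?powRr1 ?(ltW r0)//; last by rewrite (gt_eqF r0) implybT.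
    by field; rewrite !gt_eqF.
  have := derive0_pos_cst df t0 ltr01; rewrite /f P1 powR1 mul1r powRN.
  move/(congr1 ( *%R^~ (t `^ h))); rewrite mulfVK ?mul1r//.
  by rewrite gt_eqF// powR_gt0.
rewrite lin// PE// powRB ?powRr1 ?(ltW s0)//; last by rewrite (gt_eqF s0) implybT.
by field; rewrite !gt_eqF// powR_gt0.
Qed.

End Fibre.

(** * The tangent spaces of a conformal isomorphism *)

Section Construction.
Context {R : realType} {N : nat}.
Implicit Types (K : 'rV[R]_N -> 'rV[R]_N -> R) (x u v w y : 'rV[R]_N).

Lemma open_nonzero : open (@nonzero R N).
Proof.
have -> : @nonzero R N = ~` [set 0].
  by apply/seteqP; split => y /= /eqP.
apply: closed_openC.
exact/accessible_closed_set1/hausdorff_accessible/norm_hausdorff.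
Qed.

Lemma Finsler_K0 M K x : Finsler_metric_function M K -> M x -> K x 0 = 0.
Proof.
move=> hK Mx; have := Finsler_homogeneous hK 0 Mx (ltr0n R 2).
by rewrite scaler0; lra.
Qed.

(** One half of the n-th partial derivative of K^2. *)
Definition half_gradient_sqr K x n v := K x v * 'D_(basis_vec n) (K x) v.

Section FinslerFibre.
Variables (M : set 'rV[R]_N) (K : 'rV[R]_N -> 'rV[R]_N -> R) (x : 'rV[R]_N).
Hypotheses (hK : Finsler_metric_function M K) (Mx : M x).

Lemma Finsler_differentiable y : y != 0 -> differentiable (K x) y.
Proof.
by move=> y0; apply: (class_C1_differentiable open_nonzero (Finsler_C2 hK Mx)).
Qed.

Lemma half_gradient_differentiable n y : y != 0 ->
  differentiable (half_gradient_sqr K x n) y.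
Proof.
move=> y0; apply: differentiableM; first exact: Finsler_differentiable.
have [_ /(_ n)[_ C1]] := Finsler_C2 hK Mx.
exact: (@class_C1_differentiable _ _ 0 _ ('D_(basis_vec n) (K x)) y open_nonzero C1).
Qed.

Lemma half_gradient_homogeneous n y c : 0 < c ->
  half_gradient_sqr K x n (c *: y) = c * half_gradient_sqr K x n y.
Proof.
move=> c0; rewrite /half_gradient_sqr (Finsler_homogeneous hK)//.
have [->|y0] := eqVneq y 0; first by rewrite (Finsler_K0 hK)// !mulr0 !mul0r mulr0.
have cy0 : c *: y != 0 by rewrite scaler_eq0 negb_or gt_eqF.
rewrite -mulrA; congr (_ * (_ * _)).
apply: (mulfI (lt0r_neq0 c0)).
apply: (derive_scale _ _ (Finsler_differentiable y0) (Finsler_differentiable cy0)).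
by move=> v; exact: (Finsler_homogeneous hK).
Qed.

Lemma metric_tensorE y m n : y != 0 ->
  metric_tensor K x y m n = 'D_(basis_vec m) (half_gradient_sqr K x n) y.
Proof.
move=> y0; rewrite /metric_tensor.
have E : \forall v \near y, 'D_(basis_vec n) (fun w => K x w ^+ 2) v =
    ((2 : R) \*: half_gradient_sqr K x n) v.
  apply: (@filterS _ (nbhs y) _ (@nonzero R N)).
    move=> v v0; have dK := diff_derivable (Finsler_differentiable v0).
    have -> : (fun w => K x w ^+ 2) = K x ^+ 2 by [].
    by rewrite deriveX// expr1 /GRing.scale/= -mulrA.
  exact: (open_nbhs_nbhs (conj open_nonzero y0)).
rewrite (near_eq_derive _ E) deriveZ; last first.
  exact/diff_derivable/half_gradient_differentiable.
by rewrite /GRing.scale/= mulrA mulVf ?mul1r// pnatr_eq0.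
Qed.

Definition metric_form y v w :=
  \sum_m \sum_n metric_tensor K x y m n * v 0 m * w 0 n.

Lemma metric_formE y v w : y != 0 -> metric_form y v w =
  \sum_n w 0 n * 'D_v (half_gradient_sqr K x n) y.
Proof.
move=> y0; rewrite /metric_form exchange_big; apply: eq_bigr => n _.
rewrite derive_sum_basis; last exact: half_gradient_differentiable.
rewrite mulr_sumr; apply: eq_bigr => m _.
by rewrite (metric_tensorE _ _ y0) /GRing.scale/=; ring.
Qed.

(** The first slot contracts the derivative of the gradient of K^2 / 2, which is
    homogeneous of degree one, with its base point: Euler's identity. *)
Lemma metric_form_radial y v : y != 0 ->
  metric_form y y v = K x y * 'D_v (K x) y.
Proof.
move=> y0; rewrite (metric_formE _ _ y0) (derive_sum_basis v (Finsler_differentiable y0)).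
rewrite mulr_sumr; apply: eq_bigr => n _.
rewrite Euler_homogeneous; last exact: half_gradient_differentiable.
  by rewrite /half_gradient_sqr /GRing.scale/=; ring.
by move=> c c0; exact: half_gradient_homogeneous.
Qed.

Lemma metric_form_scale y v w c : y != 0 -> 0 < c ->
  metric_form (c *: y) v w = metric_form y v w.
Proof.
move=> y0 c0; have cy0 : c *: y != 0 by rewrite scaler_eq0 negb_or gt_eqF.
rewrite (metric_formE v w cy0).
rewrite (metric_formE v w y0).
apply: eq_bigr => n _.
apply: (congr1 ( *%R (w 0 n))).
apply: (mulfI (lt0r_neq0 c0)); apply: derive_scale.
- by move=> z; exact: half_gradient_homogeneous.
- exact: half_gradient_differentiable.
- exact: half_gradient_differentiable.
Qed.

Lemma Finsler_unit : (0 < N)%N -> exists u, K x u = 1.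
Proof.
move=> N0; pose e : 'rV[R]_N := basis_vec (Ordinal N0).
have e0 : e != 0.
  by apply/eqP => /rowP/(_ (Ordinal N0))/eqP; rewrite !mxE !eqxx oner_eq0.
have Ke := Finsler_pos hK Mx e0.
exists ((K x e)^-1 *: e).
by rewrite (Finsler_homogeneous hK) ?invr_gt0// mulVf// gt_eqF.
Qed.

End FinslerFibre.

(** The transformation law of g is the equality
    g_y(v, w) = vk(K)^2 a(D_v Z, D_w Z) of bilinear forms, in coordinates; the
    properties of g then become those of [conformal_fibre]. *)
Lemma conformal_isomorphism_fibre (hN : (0 < N)%N) M K a T Z k vk x :
  Finsler_metric_function M K -> Riemannian_metric M a ->
  conformally_isomorphic M K a T Z k -> multiplier_function_of_metric M K k vk ->
  M x -> conformal_fibre (K x) (a x) (T x) (Z x) (vk x).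
Proof.
move=> hK ha [hT [k0 gE]] hvk Mx.
have asym m n : a x m n = a x n m by exact: Riemannian_symmetric ha _ _ _ Mx.
have dZ y : y != 0 -> differentiable (Z x) y.
  exact: (class_C1_differentiable_row open_nonzero (transf_inv_C5 hT Mx)).
have formE y v w : y != 0 -> metric_form K x y v w =
    vk x (K x y) ^+ 2 * dot (a x) ('D_v (Z x) y) ('D_w (Z x) y).
  move=> y0; rewrite !(derive_sum_basis _ (dZ y y0)) dot_suml mulr_sumr.
  apply: eq_bigr => m _; rewrite (dotC asym) dot_suml mulr_sumr.
  apply: eq_bigr => n _; rewrite dotZl (dotC asym) dotZl gE// hvk//.
  have dZm l : derivable (Z x) y (basis_vec l) by exact/diff_derivable/dZ.
  suff -> : \sum_(i < N) \sum_(j < N)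
      'D_(basis_vec m) (fun w => Z x w 0 i) y *
      'D_(basis_vec n) (fun w => Z x w 0 j) y * a x i j =
      dot (a x) ('D_(basis_vec m) (Z x) y) ('D_(basis_vec n) (Z x) y).
    by ring.
  apply: eq_bigr => i _; apply: eq_bigr => j _.
  by rewrite !derive_coord//; ring.
split.
- exact: Finsler_K0 hK Mx.
- by move=> y; exact: (Finsler_pos hK Mx).
- by move=> y c; exact: (Finsler_homogeneous hK y Mx).
- move=> y; apply: (@continuous_comp _ _ _ (fun y => (x, y)) (fun p => K p.1 p.2)).
    apply/differentiable_continuous/differentiable_pair; last exact: ex_diff.
    exact: differentiable_cst.
  exact: (Finsler_continuous hK Mx).
- by move=> y; exact: (Finsler_differentiable hK Mx).
- exact: asym.
- by move=> v; exact: (Riemannian_posdef ha Mx).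
- exact: (transf_K hT Mx).
- exact: (transf_inv_K hT Mx).
- exact: (transf_0 hT Mx).
- exact: (transf_continuous hT Mx).
- exact: (transf_inv_continuous hT Mx).
- move=> v; exact: (class_C1_differentiable_row open_nonzero (transf_C5 hT Mx)).
- exact: dZ.
- move=> s s0; have [u Ku] := Finsler_unit hK Mx hN.
  have u0 : u != 0.
    by apply: contra_eq_neq Ku => ->; rewrite (Finsler_K0 hK)// eq_sym oner_eq0.
  have su0 : s *: u != 0 by rewrite scaler_eq0 negb_or gt_eqF.
  rewrite -[s]mulr1 -Ku -(Finsler_homogeneous hK)// -hvk//.
  exact: k0.
- by move=> y v y0; rewrite -formE//; exact: (metric_form_radial hK Mx).
- move=> y v s y0 s0; have sy0 : s *: y != 0 by rewrite scaler_eq0 negb_or gt_eqF.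
  rewrite -(formE (s *: y) v v sy0) -(formE y v v y0).
  exact: metric_form_scale hK Mx _ _ _ _ y0 s0.
Qed.

End Construction.

Theorem theorem2p1 (R : realType) (N : nat) (hN : (1 < N)%N)
    (M : set 'rV[R]_N) (hM : open M)
    (K : 'rV[R]_N -> 'rV[R]_N -> R) (hK : Finsler_metric_function M K)
    (a : 'rV[R]_N -> 'M[R]_N) (ha : Riemannian_metric M a)
    (T Z : 'rV[R]_N -> 'rV[R]_N -> 'rV[R]_N)
    (k : 'rV[R]_N -> 'rV[R]_N -> R)
    (vk : 'rV[R]_N -> R -> R) :
  (conformally_isomorphic M K a T Z k /\
   unit_vectors_to_unit_vectors M K a T /\
   multiplier_function_of_metric M K k vk)
  <->
  (conformally_isomorphic M K a T Z k /\
   multiplier_function_of_metric M K k vk /\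
   exists h : 'rV[R]_N -> R,
     (forall x, M x -> 0 < h x) /\
     (forall x (s : R), M x -> 0 < s -> vk x s = (h x)^-1 * s `^ (1 - h x))).
Proof.
have sqr1 x v : Riemannian_square a x v = 1 <-> nrm (a x) v = 1.
  rewrite /nrm -[dot _ _ _]/(Riemannian_square a x v); split => [->|H].
    exact: sqrtr1.
  rewrite -(@sqr_sqrtr _ (Riemannian_square a x v)) ?H ?expr1n//.
  by rewrite ltW// -sqrtr_gt0 H.
split => [[hC [hU hm]]|[hC [hm [h [h0 vkE]]]]].
- split=> //; split=> //; exists (fun x => (vk x 1)^-1); split => x.
    move=> Mx; rewrite invr_gt0.
    exact: (fib_vk (conformal_isomorphism_fibre (ltnW hN) hK ha hC hm Mx)).
  move=> s Mx s0.
  have F := conformal_isomorphism_fibre (ltnW hN) hK ha hC hm Mx.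
  have [u Ku] := Finsler_unit hK Mx (ltnW hN).
  have u0 : u != 0.
    by apply: contra_eq_neq Ku => ->; rewrite (fib_K0 F) eq_sym oner_eq0.
  have [v v0 Dv] := derive_kernel hN (fib_dK F u0).
  apply: (multiplier_of_unit F Ku v0 Dv) => //.
  (* Z u is a unit vector, as u is the image of one *)
  have : [set y | K x y = 1] u by [].
  rewrite hU// => -[z /= z1 <-]; rewrite (fib_TK F).
  exact/sqr1.
- split=> //; split=> // x Mx.
  have F := conformal_isomorphism_fibre (ltnW hN) hK ha hC hm Mx.
  have [u Ku] := Finsler_unit hK Mx (ltnW hN).
  have ZE y : y != 0 -> nrm (a x) (Z x y) = K x y `^ h x.
    move=> y0; rewrite (nrm_Z_profile F _ Ku).
    apply: (profile_of_multiplier F Ku (h0 _ Mx)); last exact: (fib_K_gt0 F).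
    by move=> t; exact: vkE.
  apply/seteqP; split=> [y/= Ky|_ [z /= /sqr1 z1 <-]].
    exists (Z x y); last exact: (fib_ZK F).
    apply/sqr1; rewrite ZE ?Ky ?powR1//.
    by apply: contra_eq_neq Ky => ->; rewrite (fib_K0 F) eq_sym oner_eq0.
  have z0 : z != 0.
    by apply: contra_eq_neq z1 => ->; rewrite nrm0 eq_sym oner_eq0.
  have Tz0 := fib_T_neq0 F z0.
  have := ZE _ Tz0; rewrite (fib_TK F) z1 => /esym/eqP.
  have Kz := fib_K_gt0 F Tz0.
  by rewrite powR_eq1 (gt_eqF (h0 _ Mx)) (ltNge _ 0) (ltW Kz) !orbF => /eqP.
Qed.
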